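(* Let $n\in\mathbb{N}\cup\{0\}$ and let $q\neq 0$ be a complex number. (i) The matrix $\left(\frac{1+(-1)^{j+k}}{2}\,q^{-(j+k)^{2}/4}\,(q;q^{2})_{\left\lfloor \frac{j+k}{2}\right\rfloor}\right)_{j,k=0}^{n}$ has determinant $$\det\left(\frac{1+(-1)^{j+k}}{2}\,q^{-(j+k)^{2}/4}\,(q;q^{2})_{\left\lfloor \frac{j+k}{2}\right\rfloor}\right)_{j,k=0}^{n}=\frac{\prod_{k=0}^{n}(q;q)_{k}}{q^{n(n+1)(2n+1)/6}}.$$ (ii) If $q^{k}\neq 1$ for every $k\in\mathbb{N}$, then this matrix is invertible, and its inverse is the matrix $$\left(\sum_{m=\max(j,k)}^{n}\frac{\left[\begin{array}{c}m\\ j\end{array}\right]_{q}\left[\begin{array}{c}m\\ k\end{array}\right]_{q}(q;q^{2})_{\left\lfloor \frac{m-j}{2}\right\rfloor}(q;q^{2})_{\left\lfloor \frac{m-k}{2}\right\rfloor}\cos\frac{(m-j)\pi}{2}\cos\frac{(m-k)\pi}{2}}{(-1)^{m}(q;q)_{m}\,q^{-m-\binom{j}{2}-\binom{k}{2}}}\right)_{j,k=0}^{n}.$$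
   Context: $\mathbb{N}=\{1,2,3,\dots\}$. For complex $x,p$ and an integer $m\ge 0$, $(x;p)_{m}:=\prod_{i=0}^{m-1}(1-xp^{i})$, with $(x;p)_0=1$. For integers $0\le j\le m$, $\left[\begin{array}{c}m\\ j\end{array}\right]_{q}:=\frac{(q;q)_{m}}{(q;q)_{j}(q;q)_{m-j}}$. $\lfloor x\rfloor$ is the integer part (floor) of the real number $x$, and $\binom{j}{2}=j(j-1)/2$. Matrices are indexed by $j,k=0,1,\dots,n$. Entries of the first matrix with $j+k$ odd are $0$ because of the factor $\frac{1+(-1)^{j+k}}{2}$.
   Formalization: In (ii) the factor (-1)^m in the denominator of the inverse's entries is removed: as printed the formula fails for every n ≥ 1 (for n = 1 the (1,1) entry should be q/(1-q), but the printed one is -q/(1-q)). *)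

(* Defs.v *)
From mathcomp Require Import all_boot all_order all_algebra.
From mathcomp Require Import reals trigo.
From mathcomp Require Import complex.

Set Implicit Arguments.
Unset Strict Implicit.
Unset Printing Implicit Defensive.

Import Order.TTheory GRing.Theory Num.Theory.
Local Open Scope ring_scope.
Local Open Scope complex_scope.

(* (x; p)_m *)
Definition qpoch (F : fieldType) (x p : F) (m : nat) : F :=
  \prod_(i < m) (1 - x * p ^+ i).

(* Only meaningful for j <= m, since m - j is truncated. *)
Definition qbinom (F : fieldType) (q : F) (m j : nat) : F :=
  qpoch q q m / (qpoch q q j * qpoch q q (m - j)).

(* The first factor vanishes when j + k is odd; when j + k is even, 4 divides
   (j + k) ^ 2, so the natural-number quotient is the exact exponent. *)
Definition hankel_entry (F : fieldType) (q : F) (j k : nat) : F :=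
  (1 + (-1) ^+ (j + k)) / 2%:R * q ^- ((j + k) ^ 2 %/ 4)
    * qpoch q (q ^+ 2) (j + k)./2.

Definition hankel_mx (F : fieldType) (q : F) (n : nat) : 'M[F]_n.+1 :=
  \matrix_(j < n.+1, k < n.+1) hankel_entry q j k.

(* The denominator carries no factor (-1) ^+ m: for n = 1 the hankel matrix is
   diagonal with entries 1 and (1 - q) / q, so the last entry of its inverse is
   q / (1 - q), whereas such a factor would make it - q / (1 - q). *)
Definition hankel_inv_entry (R : realType) (q : R[i]) (n j k : nat) : R[i] :=
  \sum_(maxn j k <= m < n.+1)
    (qbinom q m j * qbinom q m k
       * qpoch q (q ^+ 2) (m - j)./2 * qpoch q (q ^+ 2) (m - k)./2
       * (cos ((m - j)%:R * pi / 2%:R))%:C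
       * (cos ((m - k)%:R * pi / 2%:R))%:C)
    / (qpoch q q m * q ^- (m + 'C(j, 2) + 'C(k, 2))).

Definition hankel_inv_mx (R : realType) (q : R[i]) (n : nat) : 'M[R[i]]_n.+1 :=
  \matrix_(j < n.+1, k < n.+1) hankel_inv_entry q n j k.

(* Main.v *)
Require Import Defs.
From mathcomp Require Import all_boot all_order all_algebra.
From mathcomp Require Import reals trigo.
From mathcomp Require Import complex.
From mathcomp Require Import ring zify.

Set Implicit Arguments.
Unset Strict Implicit.

Import GRing.Theory.
Local Open Scope ring_scope.

(** The matrix is the Hankel matrix of the moments of the discrete q-Hermite
    polynomials of type II, the monic polynomials with
      [h_0 = 1], [h_(m+1) = x h_m - lam_(m-1) h_(m-1)],
      [lam_m = (1 - q^(m+1)) / q^(2m+1)],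
    where [h_(-1) = 0], whose squared norms are
      [D_m = lam_0 ... lam_(m-1) = (q;q)_m / q^(m^2)].
    Write [x^k = sum_m B_(k,m) h_m] and [h_m = sum_j A_(m,j) x^j], so that [B]
    and [A] are mutually inverse unitriangular matrices.  Orthogonality amounts
    to [H = B D B^T], from which the determinant is [prod_m D_m] and the inverse
    is [A^T D^-1 A].

    Neither the polynomials nor an orthogonality measure appears below.  Both
    [B] and [A] are given by closed forms, and everything follows from
    multiplication by [x] being a tridiagonal operator:
    - [qh_expandS]: consecutive rows of [B] are related by the tridiagonal
      matrix [J] of multiplication by [x];
    - [qh_coef_rec]: the three-term recurrence, which relates the columns of
      [A] by the transpose of [J];
    - [jacobi_adjoint]: summation by parts, which moves [J] across a sum.
    Since [D] symmetrizes [J], the entry [(B D B^T)_(j,k)] depends on [j + k]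
    only, hence equals [B_(j+k,0)] ([qh_gram]), and this is the moment of order
    [j + k] ([qh_moment]).  Similarly [B A = 1] follows by induction on the row
    ([qh_expand_coef]).

    The determinant formula must hold also when [q] is a root of unity, where
    the quotient of q-factorials is not the Gaussian binomial.  Therefore the
    Gaussian binomials are defined by the q-Pascal rule, and are identified with
    the quotients only for the inverse. *)

(** * Tridiagonal operators on sequences *)

Section Jacobi.
Variables (F : comPzRingType) (lam : nat -> F).
Implicit Types a c : nat -> F.

(** The action of multiplication by the variable on the coefficients of a
    combination of the monic polynomials with three-term coefficients [lam]. *)
Definition jacobi a m := (if m is p.+1 then a p else 0) + lam m * a m.+1.
Definition jacobi_tr c m := c m.+1 + (if m is p.+1 then lam p * c p else 0).

(** Summation by parts; the vanishing conditions remove the boundary terms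
    created by truncating the sum. *)
Lemma jacobi_adjoint a c N : a N = 0 -> a N.+1 = 0 ->
  \sum_(m < N.+1) jacobi a m * c m = \sum_(m < N.+1) a m * jacobi_tr c m.
Proof.
move=> aN aN1.
under eq_bigr do rewrite mulrDl.
under [RHS]eq_bigr do rewrite mulrDr.
rewrite !big_split /=; congr (_ + _).
  by rewrite big_ord_recl big_ord_recr /= aN !mul0r add0r addr0.
rewrite big_ord_recr [RHS]big_ord_recl /= aN1 !(mulr0, mul0r) add0r addr0.
by apply: eq_bigr => i _; rewrite /bump /=; ring.
Qed.

End Jacobi.

(** * Gaussian binomials without division *)

Section QHermite.
Variables (F : fieldType) (q : F).

(** The truncation in [m' - k'] is harmless: when it matters, [gauss m' k'] is
    zero. *)
Fixpoint gauss (m k : nat) : F :=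
  match m, k with
  | _, 0%N => 1
  | 0%N, _.+1 => 0
  | m'.+1, k'.+1 => q ^+ (m' - k') * gauss m' k' + gauss m' k'.+1
  end.

Lemma gaussm0 m : gauss m 0 = 1. Proof. by case: m. Qed.

Lemma gaussSS m k :
  gauss m.+1 k.+1 = q ^+ (m - k) * gauss m k + gauss m k.+1.
Proof. by []. Qed.

Lemma gauss_small m k : (m < k)%N -> gauss m k = 0.
Proof.
elim: m k => [|m IH] [|k] //= km.
by rewrite !IH ?mulr0 ?addr0 //; lia.
Qed.

Lemma gaussmm m : gauss m m = 1.
Proof. by elim: m => //= m ->; rewrite subnn gauss_small // mulr1 addr0. Qed.

(** Up to the factor [1 - q], both sides are the q-multinomial coefficient with
    parts [k], [1] and [m - k - 1].  This and [gauss_absorb_top] replace the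
    formula by q-factorials wherever dividing by them would be illegitimate. *)
Lemma gauss_absorb m k :
  (1 - q ^+ k.+1) * gauss m k.+1 = (1 - q ^+ (m - k)) * gauss m k.
Proof.
elim: m k => [|m IH] k; first by rewrite /= sub0n expr0 subrr mulr0 mul0r.
rewrite gaussSS mulrDr IH.
case: (leqP k m) => [km|mk]; last first.
  rewrite gauss_small //; have -> : (m.+1 - k = 0)%N by lia.
  by rewrite expr0 subrr !(mulr0, mul0r) addr0.
case: k km => [|k] km.
  by rewrite !gaussm0 !subn0 (exprS q m) expr1; ring.
have := IH k; rewrite gaussSS subSS.
have -> : (m - k = (m - k.+1).+1)%N by lia.
move: (gauss m k) (gauss m k.+1) (m - k.+1)%N => x y d E.
have -> : (1 - q ^+ d.+1) * (q ^+ d.+1 * x + y)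
  = q ^+ d.+1 * ((1 - q ^+ d.+1) * x) + (1 - q ^+ d.+1) * y by ring.
by rewrite -E !exprS; ring.
Qed.

Lemma gauss_absorb_top m k : (k <= m)%N ->
  (1 - q ^+ (m.+1 - k)) * gauss m.+1 k = (1 - q ^+ m.+1) * gauss m k.
Proof.
case: k => [|k] km; first by rewrite !gaussm0 subn0.
rewrite gaussSS subSS mulrDr mulrCA -gauss_absorb.
have -> : q ^+ m.+1 = q ^+ (m - k) * q ^+ k.+1 by rewrite -exprD; congr (_ ^+ _); lia.
ring.
Qed.

Lemma qpochS (x p : F) m : qpoch x p m.+1 = qpoch x p m * (1 - x * p ^+ m).
Proof. by rewrite /qpoch big_ord_recr. Qed.

Lemma gauss_qpoch k t :
  gauss (t + k) k * (qpoch q q k * qpoch q q t) = qpoch q q (t + k).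
Proof.
elim: t => [|t IH]; first by rewrite add0n gaussmm /qpoch big_ord0 mulr1 mul1r.
rewrite addSn !qpochS -!exprS -IH.
have := gauss_absorb_top (leq_addl t k).
have -> : ((t + k).+1 - k = t.+1)%N by lia.
move=> E; transitivity (qpoch q q k * qpoch q q t * ((1 - q ^+ t.+1) * gauss (t + k).+1 k)).
  by ring.
by rewrite E; ring.
Qed.

Lemma qpoch_neq0 m : (forall i : nat, (0 < i)%N -> q ^+ i != 1) ->
  qpoch q q m != 0.
Proof.
by move=> q1; apply/prodf_neq0 => j _; rewrite -exprS subr_eq0 eq_sym q1.
Qed.

Lemma gauss_qbinom m k : (forall i : nat, (0 < i)%N -> q ^+ i != 1) ->
  (k <= m)%N -> qbinom q m k = gauss m k.
Proof.
move=> q1 km; rewrite /qbinom -{1}(subnK km) -gauss_qpoch subnK // mulfK //.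
by rewrite mulf_neq0 ?qpoch_neq0.
Qed.

(** * Discrete q-Hermite polynomials: closed forms and recurrences *)

Definition qh_lam m := (1 - q ^+ m.+1) / q ^+ (2 * m + 1).
Definition qh_norm m := qpoch q q m / q ^+ (m ^ 2).

(** The coefficient of [h_m] in [x^k].  With [k = m + 2 s] the exponent
    [s (s + 2 m)] is [((k + m) / 2)^2 - m^2]. *)
Definition qh_expand k m :=
  if odd (k - m) then 0 else
  let s := (k - m)./2 in
  gauss k m * qpoch q (q ^+ 2) s / q ^+ (s * (s + 2 * m)).

(** The coefficient of [x^j] in [h_m]. *)
Definition qh_coef m j :=
  if odd (m - j) then 0 else
  let s := (m - j)./2 in
  gauss m j * qpoch q (q ^+ 2) s * (-1) ^+ s * (q ^+ 'C(j, 2) / q ^+ 'C(m, 2)).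

Lemma qh_expand_small k m : (k < m)%N -> qh_expand k m = 0.
Proof. by move=> km; rewrite /qh_expand gauss_small // !mul0r if_same. Qed.

Lemma qh_expandmm m : qh_expand m m = 1.
Proof. by rewrite /qh_expand subnn /= gaussmm /qpoch big_ord0 mul0n divr1 mulr1. Qed.

Lemma qh_expand_even t m : qh_expand (t.*2 + m) m =
  gauss (t.*2 + m) m * qpoch q (q ^+ 2) t / q ^+ (t * (t + 2 * m)).
Proof. by rewrite /qh_expand addnK odd_double doubleK. Qed.

Lemma qh_expand_odd t m : qh_expand (t.*2.+1 + m) m = 0.
Proof. by rewrite /qh_expand addnK /= odd_double. Qed.

Lemma qh_coef_small m j : (m < j)%N -> qh_coef m j = 0.
Proof. by move=> km; rewrite /qh_coef gauss_small // !mul0r if_same. Qed.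

Lemma qh_coef_even t j : qh_coef (t.*2 + j) j =
  gauss (t.*2 + j) j * qpoch q (q ^+ 2) t * (-1) ^+ t
    * (q ^+ 'C(j, 2) / q ^+ 'C(t.*2 + j, 2)).
Proof. by rewrite /qh_coef addnK odd_double doubleK. Qed.

Lemma qh_coef_odd t j : qh_coef (t.*2.+1 + j) j = 0.
Proof. by rewrite /qh_coef addnK /= odd_double. Qed.

Hypothesis q0 : q != 0.

Lemma qh_coefmm m : qh_coef m m = 1.
Proof.
by rewrite /qh_coef subnn /= gaussmm /qpoch big_ord0 !mul1r divff ?expf_neq0.
Qed.

Lemma qh_normS m : qh_norm m.+1 = qh_lam m * qh_norm m.
Proof.
rewrite /qh_norm /qh_lam qpochS -exprS.
have -> : (m.+1 ^ 2 = (2 * m + 1) + m ^ 2)%N by lia.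
rewrite exprD; field.
by rewrite !expf_neq0.
Qed.

Lemma qpoch_sqS t : qpoch q (q ^+ 2) t.+1 = qpoch q (q ^+ 2) t * (1 - q ^+ (t.*2.+1)).
Proof. by rewrite qpochS -exprM -exprS mul2n. Qed.

(** In the one case that is not trivial, [k + 1 = m + 2 (t + 1)], a common
    factor comes out of all three terms.  What remains is the q-Pascal rule for
    [gauss k.+1 m] multiplied by [1 - q^(2t+1)], the last factor of
    [(q;q^2)_(t+1)]; the term in [gauss k m.+1] takes this factor by
    [gauss_absorb]. *)
Lemma qh_expandS k m : qh_expand k.+1 m = jacobi qh_lam (qh_expand k) m.
Proof.
rewrite /jacobi; case: (ltngtP m k.+1) => [mk|km|->].
- have [t kE] : exists t, k = (t + m)%N by exists (k - m)%N; lia.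
  (* For [t] even, [k + 1 - m] is odd and every term vanishes. *)
  rewrite {}kE {mk k}; case: (boolP (odd t)) => ot; last first.
    have -> : t = (t./2).*2 by lia.
    rewrite -addSn qh_expand_odd; move: (t./2) => {ot}t.
    have -> : qh_expand (t.*2 + m) m.+1 = 0.
      case: t => [|t]; first by rewrite qh_expand_small.
      by rewrite (_ : (t.+1.*2 + m = t.*2.+1 + m.+1)%N) ?qh_expand_odd //; lia.
    case: m => [|m]; first by rewrite mulr0 addr0.
    by rewrite addnS -addSn qh_expand_odd mulr0 addr0.
  have -> : t = (t./2).*2.+1 by lia.
  move: (t./2) => {ot}t; rewrite -addSn -doubleS qh_expand_even.
  rewrite doubleS !addSn -addnS qh_expand_even addnS qpoch_sqS.
  have := gauss_absorb (t.*2 + m).+1 m.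
  have -> : ((t.*2 + m).+1 - m = t.*2.+1)%N by lia.
  rewrite /qh_lam; case: m => [|m] E.
    rewrite !gaussm0 in E *.
    have -> : (t.+1 * (t.+1 + 2 * 0) = (2 * 0 + 1) + t * (t + 2 * 1))%N by lia.
    rewrite exprD invfM add0r.
    transitivity ((1 - q ^+ 1) * gauss (t.*2 + 0).+1 1 *
       (qpoch q (q ^+ 2) t * ((q ^+ (2 * 0 + 1))^-1 / q ^+ (t * (t + 2 * 1))))).
      by rewrite E; ring.
    by ring.
  rewrite gaussSS.
  have -> : ((t.*2 + m.+1).+1 - m = t.+1.*2)%N by lia.
  have kE : ((t.*2 + m.+1).+1 = t.+1.*2 + m)%N by lia.
  rewrite !kE in E *.
  rewrite qh_expand_even qpoch_sqS.
  have -> : (t.+1 * (t.+1 + 2 * m.+1) = (2 * m.+1 + 1) + t * (t + 2 * m.+2))%N by lia.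
  (* The surplus [q ^+ t.+1.*2] is the weight in the q-Pascal rule. *)
  have -> : (q ^+ (t.+1 * (t.+1 + 2 * m)))^-1
     = q ^+ t.+1.*2 / q ^+ (2 * m.+1 + 1 + t * (t + 2 * m.+2)).
    apply: (canRL (mulfK _)); rewrite ?expf_neq0 //.
    apply: (canLR (mulKf _)); rewrite ?expf_neq0 //.
    by rewrite -exprD; congr (_ ^+ _); lia.
  rewrite exprD invfM.
  have E' : gauss (t.+1.*2 + m) m.+2 * (1 - q ^+ m.+2)
     = (1 - q ^+ t.*2.+1) * gauss (t.+1.*2 + m) m.+1.
    by rewrite mulrC E.
  transitivity ((q ^+ t.+1.*2 * gauss (t.+1.*2 + m) m * (1 - q ^+ t.*2.+1)
      + gauss (t.+1.*2 + m) m.+2 * (1 - q ^+ m.+2))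
    * (qpoch q (q ^+ 2) t * ((q ^+ (2 * m.+1 + 1))^-1 / q ^+ (t * (t + 2 * m.+2))))).
    by rewrite E'; ring.
  by ring.
- by case: m km => // m km; rewrite !qh_expand_small ?mulr0 ?addr0 //; lia.
- by rewrite !qh_expandmm qh_expand_small ?mulr0 ?addr0.
Qed.

(** The three-term recurrence read on coefficients.  As for [qh_expandS], it
    reduces to the q-Pascal rule multiplied by [1 - q^(2t+1)], now with
    [gauss_absorb_top] turning [1 - q^(m+1)] into that factor. *)
Lemma qh_coef_rec m j :
  jacobi_tr qh_lam (qh_coef^~ j) m = if j is i.+1 then qh_coef m i else 0.
Proof.
rewrite /jacobi_tr; case: (ltngtP j m.+1) => [jm|mj|->].
- have [t mE] : exists t, m = (t + j)%N by exists (m - j)%N; lia.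
  (* For [t] even, [m + 1 - j] is odd and every term vanishes. *)
  rewrite {}mE {jm m}; case: (boolP (odd t)) => ot; last first.
    have -> : t = (t./2).*2 by lia.
    rewrite -addSn qh_coef_odd add0r; move: (t./2) => {ot}t.
    have -> : (if j is i.+1 then qh_coef (t.*2 + j) i else 0) = 0.
      case: j => // i.
      by rewrite addnS -addSn qh_coef_odd.
    case: t => [|t]; last by rewrite doubleS !addSn -addSn qh_coef_odd mulr0.
    by case: j => // j; rewrite add0n /= qh_coef_small ?mulr0.
  have -> : t = (t./2).*2.+1 by lia.
  move: (t./2) => {ot}t; rewrite -addSn -doubleS qh_coef_even addSn qh_coef_even.
  rewrite doubleS !addSn qpoch_sqS /qh_lam.
  set M := (t.*2 + j)%N.
  have binE : 'C(M.+2, 2) = ((2 * M + 1) + 'C(M, 2))%N.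
    by rewrite !binS !bin1 bin0; lia.
  have nzM : q ^+ 'C(M, 2) != 0 by rewrite expf_neq0.
  have nzL : q ^+ (2 * M + 1) != 0 by rewrite expf_neq0.
  have MS : 'C(M.+1, 2) = (M + 'C(M, 2))%N by rewrite binS bin1 addnC.
  rewrite binE exprD.
  have := gauss_absorb_top (leq_addl _ _ : (j <= M)%N).
  have -> : (M.+1 - j = t.*2.+1)%N by rewrite /M; lia.
  case: j @M binE nzM nzL MS => [|i] M binE nzM nzL MS E.
    rewrite !gaussm0 !mulr1 in E *.
    by rewrite E (exprS (-1)); field; rewrite nzM nzL.
  have -> : qh_coef M.+1 i = qh_coef (t.+1.*2 + i) i by congr qh_coef; rewrite /M; lia.
  rewrite qh_coef_even qpoch_sqS.
  have -> : (t.+1.*2 + i)%N = M.+1 by rewrite /M; lia.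
  rewrite gaussSS.
  have -> : (M.+1 - i)%N = t.+1.*2 by rewrite /M; lia.
  have nzm : q ^+ M != 0 by rewrite expf_neq0.
  have iE : q ^+ 'C(i.+1, 2) = q ^+ i * q ^+ 'C(i, 2) by rewrite binS bin1 addnC exprD.
  have LE : q ^+ (2 * M + 1) = q ^+ t.+1.*2 * q ^+ i * q ^+ M.
    by rewrite -!exprD; congr (_ ^+ _); rewrite /M; lia.
  rewrite MS iE LE exprD.
  have nzt : q ^+ t.+1.*2 != 0 by rewrite expf_neq0.
  have nzi : q ^+ i != 0 by rewrite expf_neq0.
  transitivity ((q ^+ t.+1.*2 * gauss M.+1 i * (1 - q ^+ t.*2.+1)
      + (1 - q ^+ t.*2.+1) * gauss M.+1 i.+1 - (1 - q ^+ M.+1) * gauss M i.+1)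
    * (qpoch q (q ^+ 2) t * (-1) ^+ t.+1 * (q ^+ i * q ^+ 'C(i, 2) /
      (q ^+ t.+1.*2 * q ^+ i * q ^+ M * q ^+ 'C(M, 2))))).
    by rewrite (exprS (-1)); field; rewrite nzM nzm nzt nzi.
  by rewrite E; field; rewrite nzM nzm nzt nzi.
- case: j mj => // j mj; rewrite (qh_coef_small mj) (@qh_coef_small m j) ?add0r; last by lia.
  by case: m mj => [|m] mj; rewrite ?addr0 // qh_coef_small ?mulr0 ?addr0 //; lia.
- rewrite !qh_coefmm; case: m => [|m]; rewrite ?addr0 //.
  by rewrite qh_coef_small ?mulr0 ?addr0.
Qed.

(** * Factorization of the Hankel matrix *)

(** Multiplication by [x] is self-adjoint for the form with diagonal [qh_norm],
    because [qh_norm m.+1 = qh_lam m * qh_norm m]. *)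
Lemma qh_expand_norm_sym N j k : (j < N)%N -> (k < N)%N ->
  \sum_(m < N.+1) qh_expand j.+1 m * (qh_expand k m * qh_norm m)
  = \sum_(m < N.+1) qh_expand j m * (qh_expand k.+1 m * qh_norm m).
Proof.
move=> jN kN; under eq_bigr do rewrite qh_expandS.
rewrite (@jacobi_adjoint _ qh_lam (qh_expand j) (fun m => qh_expand k m * qh_norm m)).
- apply: eq_bigr => m _; congr (_ * _); rewrite qh_expandS /jacobi /jacobi_tr.
  by case: {m}(m : nat) => [|m]; rewrite !qh_normS; ring.
- exact: qh_expand_small.
- by apply: qh_expand_small; rewrite ltnS ltnW.
Qed.

(** By self-adjointness all the powers of [x] can be moved to one side, where
    row 0 of the expansion leaves only the term [m = 0].  The bound on [N] keeps
    the truncation inactive during all [j] moves. *)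
Lemma qh_gram N j k : (j + k < N)%N ->
  \sum_(m < N.+1) qh_expand j m * (qh_expand k m * qh_norm m) = qh_expand (j + k) 0.
Proof.
elim: j k => [|j IH] k jkN.
  rewrite big_ord_recl qh_expandmm mul1r big1 ?addr0 => [|i _].
    by rewrite /qh_norm /qpoch big_ord0 divr1 mulr1.
  by rewrite qh_expand_small ?mul0r.
by rewrite qh_expand_norm_sym; [rewrite IH ?addnS //; lia|lia|lia].
Qed.

Lemma qh_gram_trunc n j k : (j <= n)%N ->
  \sum_(m < n.+1) qh_expand j m * (qh_expand k m * qh_norm m) = qh_expand (j + k) 0.
Proof.
move=> jn; rewrite -(@qh_gram (n + (j + k).+1)); last by lia.
rewrite -addSn big_split_ord /= [X in _ = _ + X]big1 ?addr0 // => i _.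
by rewrite qh_expand_small ?mul0r //=; lia.
Qed.

(** Expanding [x^(k+1)] through [J] and moving [J] to the coefficients of the
    [h_m] shifts the column from [j] to [j - 1]. *)
Lemma qh_expand_coef N k j : (k <= N)%N ->
  \sum_(m < N.+1) qh_expand k m * qh_coef m j = (k == j)%:R.
Proof.
elim: k j => [|k IH] j kN.
  rewrite big_ord_recl qh_expandmm mul1r big1 ?addr0 => [|i _].
    by case: j => [|j]; rewrite ?qh_coefmm // qh_coef_small.
  by rewrite qh_expand_small ?mul0r.
under eq_bigr do rewrite qh_expandS.
rewrite (@jacobi_adjoint _ qh_lam (qh_expand k) (qh_coef^~ j)).
- under eq_bigr do rewrite qh_coef_rec.
  case: j => [|j]; first by rewrite big1 // => i _; rewrite mulr0.
  by rewrite IH // ltnW.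
- exact: qh_expand_small.
- by apply: qh_expand_small; rewrite ltnS ltnW.
Qed.


(** Characteristic 2 is excluded because the factor selecting the even [j + k]
    is a division by 2. *)
Lemma qh_moment j k : 2%:R != 0 :> F ->
  hankel_entry q j k = qh_expand (j + k) 0.
Proof.
move=> two0; rewrite /hankel_entry; move: (j + k)%N => {j k} m.
rewrite -(odd_double_half m) -signr_odd; move: (m./2) => s; case: (odd m).
  rewrite add1n /= odd_double /= subrr !mul0r.
  by have := qh_expand_odd s 0; rewrite addn0.
rewrite add0n odd_double /= doubleK expr0 -mulr2n divff // mul1r.
have := qh_expand_even s 0; rewrite addn0 => ->.
rewrite gaussm0 mul1r muln0 addn0 mulrC; congr (_ / q ^+ _).
by rewrite -mul2n; lia.
Qed.

Definition qh_expand_mx n : 'M[F]_n.+1 := \matrix_(k, m) qh_expand k m.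
Definition qh_coef_mx n : 'M[F]_n.+1 := \matrix_(m, j) qh_coef m j.
Definition qh_norm_row n : 'rV[F]_n.+1 := \row_m qh_norm m.

Lemma hankel_mx_LDL n : 2%:R != 0 :> F ->
  hankel_mx q n
  = qh_expand_mx n *m diag_mx (qh_norm_row n) *m (qh_expand_mx n)^T.
Proof.
move=> two0; apply/matrixP => j k; rewrite !mxE qh_moment //.
rewrite -(@qh_gram_trunc n) ?leq_ord //; apply: eq_bigr => m _.
by rewrite mul_mx_diag !mxE mulrA mulrAC.
Qed.

Lemma qh_expand_coef_mx n : qh_expand_mx n *m qh_coef_mx n = 1%:M.
Proof.
apply/matrixP => k j; rewrite !mxE -(@qh_expand_coef n) ?leq_ord //.
by apply: eq_bigr => m _; rewrite !mxE.
Qed.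

Lemma sum_sqr_div6 n : (n * (n + 1) * (2 * n + 1) %/ 6 = \sum_(k < n.+1) k ^ 2)%N.
Proof.
suff -> : (n * (n + 1) * (2 * n + 1) = (\sum_(k < n.+1) k ^ 2) * 6)%N by rewrite mulnK.
elim: n => [|n IH]; first by rewrite big_ord1.
by rewrite big_ord_recr mulnDl -IH /=; lia.
Qed.

Lemma det_hankel_mx n : 2%:R != 0 :> F ->
  \det (hankel_mx q n)
    = (\prod_(k < n.+1) qpoch q q k) / q ^+ (n * (n + 1) * (2 * n + 1) %/ 6).
Proof.
move=> two0; rewrite hankel_mx_LDL // !det_mulmx det_tr det_diag.
have -> : \det (qh_expand_mx n) = 1.
  rewrite det_trig; last first.
    by apply/is_trig_mxP => i j ij; rewrite mxE qh_expand_small.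
  by rewrite big1 // => i _; rewrite mxE qh_expandmm.
rewrite mul1r mulr1 sum_sqr_div6 -prodrXr -prodf_div.
by apply: eq_bigr => k _; rewrite mxE.
Qed.

Lemma hankel_mx_inv n : 2%:R != 0 :> F ->
  (forall k : nat, (0 < k)%N -> q ^+ k != 1) ->
  hankel_mx q n *m ((qh_coef_mx n)^T
     *m diag_mx (map_mx GRing.inv (qh_norm_row n)) *m qh_coef_mx n) = 1%:M.
Proof.
move=> two0 q1; rewrite hankel_mx_LDL // !mulmxA.
have BC := qh_expand_coef_mx n; have CB := mulmx1C BC.
rewrite -(mulmxA _ (qh_expand_mx n)^T) -trmx_mul CB trmx1 mulmx1.
rewrite -(mulmxA (qh_expand_mx n)) mulmx_diag.
rewrite (_ : diag_mx _ = 1%:M) ?mulmx1 // -diag_const_mx; congr diag_mx.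
apply/rowP => m; rewrite !mxE divff // /qh_norm mulf_neq0 ?invr_eq0 ?expf_neq0 //.
exact: qpoch_neq0.
Qed.

End QHermite.

(** * The entries of the inverse *)

Lemma cos_half_pi (R : realType) m :
  cos (m%:R * pi / 2%:R) = if odd m then 0 else (-1) ^+ m./2 :> R.
Proof.
have cosn s : cos (s%:R * pi) = (-1) ^+ s :> R.
  elim: s => [|s IH]; first by rewrite mul0r cos0.
  by rewrite -natr1 mulrDl mul1r cosDpi IH exprS mulN1r.
have sinn s : sin (s%:R * pi) = 0 :> R.
  elim: s => [|s IH]; first by rewrite mul0r sin0.
  by rewrite -natr1 mulrDl mul1r sinDpi IH oppr0.
have E s : (s.*2)%:R * pi / 2%:R = s%:R * pi :> R.
  by rewrite -muln2 natrM; field.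
rewrite -{1}(odd_double_half m); case: (odd m); last by rewrite add0n E.
rewrite natrD !mulrDl E mul1r addrC.
by rewrite cosDpihalf sinn oppr0.
Qed.

(** The cosines encode the sign and the parity condition of [qh_coef]; the
    powers of [q] agree because [m^2 = m + 2 C(m,2)], where [q^(m^2)] comes from
    the norm and each coefficient contributes one [q^-C(m,2)].  The terms with
    [m < max j k] vanish since [qh_coef] is triangular. *)
Lemma hankel_inv_entryE (R : realType) (q : R[i]) n j k : q != 0 ->
  (forall i : nat, (0 < i)%N -> q ^+ i != 1) ->
  (j <= n)%N -> (k <= n)%N ->
  hankel_inv_entry q n j k
  = \sum_(m < n.+1) qh_coef q m j / qh_norm q m * qh_coef q m k.
Proof.
move=> q0 q1 jn kn; rewrite /hankel_inv_entry.
rewrite -(big_mkord xpredT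
  (fun m => qh_coef q m j / qh_norm q m * qh_coef q m k)).
rewrite [RHS](@big_cat_nat _ _ _ (maxn j k)) //=; last by lia.
rewrite [X in X + _]big_nat_cond [X in X + _]big1 ?add0r; last first.
  move=> m; rewrite andbT => mjk.
  have [mj|mk] : (m < j)%N \/ (m < k)%N by lia.
    by rewrite (@qh_coef_small _ _ _ j) ?mul0r.
  by rewrite (@qh_coef_small _ _ _ k) ?mulr0.
rewrite !big_nat; apply: eq_bigr => m /andP[]; rewrite geq_max => /andP[jm km] _.
rewrite !gauss_qbinom // !cos_half_pi /qh_coef /qh_norm.
case: (odd (m - j)); first by rewrite !(mulr0, mul0r).
case: (odd (m - k)); first by rewrite !(mulr0, mul0r).
rewrite !rmorphXn !rmorphN1.
have nzm := qpoch_neq0 m q1.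
have -> : (m ^ 2 = m + 'C(m, 2) + 'C(m, 2))%N.
  by elim: m {jm km nzm} => // m IH; rewrite binS bin1; lia.
rewrite !exprD; field.
by rewrite nzm !expf_neq0.
Qed.

Unset Implicit Arguments.

Theorem theorem2p4 (R : realType) (n : nat) (q : R[i]) (hq : q != 0) :
  \det (hankel_mx q n)
    = (\prod_(k < n.+1) qpoch q q k) / q ^+ (n * (n + 1) * (2 * n + 1) %/ 6)
  /\ ((forall k : nat, (0 < k)%N -> q ^+ k != 1) ->
      hankel_mx q n \in unitmx /\ invmx (hankel_mx q n) = hankel_inv_mx q n).
Proof.
have two0 : 2%:R != 0 :> R[i] by rewrite Num.Theory.pnatr_eq0.
split=> [|q1]; first exact: det_hankel_mx.
have HV := hankel_mx_inv hq n two0 q1.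
have [Hu _] := mulmx1_unit HV; split=> //.
rewrite -[LHS]mulmx1 -HV mulKmx //.
apply/matrixP => j k; rewrite !mxE hankel_inv_entryE ?leq_ord //.
by apply: eq_bigr => m _; rewrite mul_mx_diag !mxE.
Qed.
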